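(* For each pair $(n,k)$ with (1) $n=4$ and $k\in\{5,7,9,11\}$, or (2) $n=5$ and $k\in\{5,7,9,11,13,15,27\}$, or (3) $n=6$ and $k=9$, or (4) $n=7$ and $k=13$, there exists a $k$-regular open XOR-magic graph of power $n$.
   Context: All graphs are simple; a graph is $k$-regular if every vertex has exactly $k$ neighbours. For a vertex $x$, $N(x)$ is its set of neighbours. A simple connected graph $G=(V,E)$ with $|V|=2^n$ is an open XOR-magic graph of power $n$ if there is a bijection $\ell:V\to(\mathbb{Z}_2)^n$ such that $\sum_{y\in N(x)}\ell(y)$ is the zero vector of $(\mathbb{Z}_2)^n$ for every $x\in V$. *)

(* Defs.v *)
From mathcomp Require Import all_boot all_order all_algebra.

Set Implicit Arguments.
Unset Strict Implicit.
Unset Printing Implicit Defensive.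

Local Open Scope ring_scope.

Definition simple_graph (V : finType) (e : rel V) : Prop :=
  symmetric e /\ irreflexive e.

Definition connected_graph (V : finType) (e : rel V) : Prop :=
  forall x y : V, connect e x y.

Definition nbhd (V : finType) (e : rel V) (x : V) : {set V} := [set y | e x y].

Definition regular_graph (V : finType) (e : rel V) (k : nat) : Prop :=
  forall x : V, #|nbhd e x| = k.

Definition open_xor_magic (V : finType) (e : rel V) (n : nat) : Prop :=
  [/\ simple_graph e, connected_graph e, #|V| = (2 ^ n)%N &
      exists2 l : V -> 'rV['Z_2]_n,
        bijective l & forall x : V, \sum_(y in nbhd e x) l y = 0].

(* Main.v *)
(** Identify the vertices with the integers below [2 ^ n] and label each one by
    its binary expansion; a neighbourhood then sums to zero exactly when every
    binary digit is set in an even number of neighbours.  Each case is settled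
    by an explicit graph.  The graphs come from a randomised search, which in
    the cases (5,5), (5,7), (5,27), (6,9) and (7,13) ranged over the graphs
    invariant under a small subgroup of GL_n(2) acting on the labels. *)

Require Import Defs.
From mathcomp Require Import all_boot all_order all_algebra.

Set Implicit Arguments.
Unset Strict Implicit.
Unset Printing Implicit Defensive.

Import GRing.Theory.

(** * Binary digits and the labelling of vertices *)

Definition digit (j x : nat) : bool := odd (x %/ 2 ^ j).

(** Induction on the number of digits: digit 0 is the parity, and digit [j.+1] of [x] is digit [j]
    of [x./2]. *)
Lemma digit_inj (n x y : nat) :
  x < 2 ^ n -> y < 2 ^ n -> (forall j, j < n -> digit j x = digit j y) -> x = y.
Proof.
elim: n x y => [|n IHn] x y; first by rewrite expn0 !ltnS !leqn0 => /eqP-> /eqP->.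
rewrite !expnSr -!ltn_divLR // !divn2 => ltx lty eq_xy.
rewrite -[x]odd_double_half -[y]odd_double_half; congr (_ + _.*2).
  by have := eq_xy 0 isT; rewrite /digit !divn1 => ->.
apply: IHn => // j ltj; have := eq_xy j.+1 ltj.
by rewrite /digit !expnS !divnMA !divn2.
Qed.

Definition label (n : nat) (x : 'I_(2 ^ n)) : 'rV['Z_2]_n :=
  (\row_j (digit j x : nat)%:R)%R.

Lemma natr_Z2_inj (b c : bool) : (b%:R = c%:R :> 'Z_2)%R -> b = c.
Proof. by case: b; case: c => // /(congr1 val). Qed.

(** Equal rows have equal digits, which gives injectivity; surjectivity follows by counting, both
    sides having [2 ^ n] elements. *)
Lemma label_bij (n : nat) : bijective (@label n).
Proof.
apply: inj_card_bij; last by rewrite card_mx card_ord card_ord mul1n.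
move=> x y /rowP eq_xy; apply/val_inj/(@digit_inj n) => [||j ltj]; rewrite ?ltn_ord //.
by have := eq_xy (Ordinal ltj); rewrite !mxE => /natr_Z2_inj.
Qed.

(** * Graphs as tables, and a computable test *)

(** A graph is stored as the list of the lists of smaller neighbours. *)
Definition adj (g : seq (seq nat)) (x y : nat) : bool :=
  (y \in nth [::] g x) || (x \in nth [::] g y).

(** Filtering [iota] yields a list without repetitions, so [size] and [count] on it are genuine
    cardinalities. *)
Definition neighbours (N : nat) (g : seq (seq nat)) (x : nat) : seq nat :=
  [seq y <- iota 0 N | adj g x y].

(** One round of breadth-first search. Removing duplicates keeps the list from growing exponentially
    with the number of rounds. *)
Definition expand (N : nat) (g : seq (seq nat)) (s : seq nat) : seq nat :=
  undup (s ++ flatten [seq neighbours N g x | x <- s]).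

(** The local conditions. Symmetry is built into [adj], and connectedness, a global condition, is
    tested once per graph by the ball in [magic_table]. *)
Definition magic_vertex (n k : nat) (g : seq (seq nat)) (x : nat) : bool :=
  let s := neighbours (2 ^ n) g x in
  [&& x \notin s, size s == k
    & all (fun j => ~~ odd (count (digit j) s)) (iota 0 n)].

(** Radius [n] is large enough for the ball about [0] to exhaust each of the
    graphs below. *)
Definition magic_table (n k : nat) (g : seq (seq nat)) : bool :=
  let ball := iter n (expand (2 ^ n) g) [:: 0] in
  all (magic_vertex n k g) (iota 0 (2 ^ n)) && all [in ball] (iota 0 (2 ^ n)).

(** * Soundness of the test *)

Definition table_rel (N : nat) (g : seq (seq nat)) : rel 'I_N := adj g.

Lemma table_relC (N : nat) (g : seq (seq nat)) : symmetric (@table_rel N g).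
Proof. by move=> x y; rewrite /table_rel /adj orbC. Qed.

(** The bridge from the abstract neighbourhood to the computed list. The operation is arbitrary
    because two are used: a sum of ones in [nat] for the degree, and a sum of digits in ['Z_2] for
    the magic condition. *)
Lemma big_nbhd (N : nat) (g : seq (seq nat)) (R : Type) (idx : R)
    (op : Monoid.com_law idx) (F : nat -> R) (x : 'I_N) :
  \big[op/idx]_(y in nbhd (table_rel g) x) F y
    = \big[op/idx]_(y <- neighbours N g x) F y.
Proof.
have ->: neighbours N g x = [seq y <- index_iota 0 N | adj g x y].
  by rewrite /index_iota subn0.
rewrite big_filter big_mkord.
by apply: eq_bigl => y; rewrite inE.
Qed.

(** Induction on the radius: a vertex added in the last round is adjacent to some [w] already
    reached. The search runs on plain numbers, so the existential also recovers the bound that makes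
    [y] a vertex. *)
Lemma connect_iter_expand (N r y : nat) (g : seq (seq nat)) (o : 'I_N) :
  y \in iter r (expand N g) [:: val o] ->
  exists2 x : 'I_N, val x = y & connect (table_rel g) o x.
Proof.
elim: r y => [|r IHr] y /=; first by rewrite inE => /eqP->; exists o.
rewrite mem_undup mem_cat => /orP[/IHr // | /flatten_mapP[w /IHr[x <- ox]]].
rewrite mem_filter mem_iota => /andP[xy /= ltyN]; exists (Ordinal ltyN) => //.
by apply: connect_trans ox _; apply: connect1.
Qed.

(** Turns each case of the theorem into a boolean evaluation, with ['I_(2 ^ n)] as vertex set and
    [label] as labelling. *)
Lemma magic_tableP (n k : nat) (g : seq (seq nat)) :
  magic_table n k g ->
  exists (V : finType) (e : rel V), regular_graph e k /\ open_xor_magic e n.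
Proof.
case/andP=> /allP vtx /allP ball.
have {}vtx (x : 'I_(2 ^ n)) : magic_vertex n k g x.
  by apply: vtx; rewrite mem_iota /= ltn_ord.
have N_gt0 : 0 < 2 ^ n by rewrite expn_gt0.
have conn0 x : connect (table_rel g) (Ordinal N_gt0) x.
  have /ball : val x \in iota 0 (2 ^ n) by rewrite mem_iota /= ltn_ord.
  move/(@connect_iter_expand _ _ _ _ (Ordinal N_gt0)).
  by case=> y /val_inj->.
exists 'I_(2 ^ n), (table_rel g); split=> [x|].
  have /and3P[_ /eqP <- _] := vtx x.
  by rewrite -sum1_card (big_nbhd _ _ (fun=> 1)) sum1_size.
split; last 1 [exists (@label n)]; rewrite ?card_ord //.
- split=> [|x]; first exact: table_relC.
  (* Since [x] is in the range of [iota], its absence from its own neighbour list can only mean that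
     it has no loop. *)
  have /and3P[] := vtx x; rewrite mem_filter mem_iota /= ltn_ord andbT.
  by move/negbTE.
(* Any two vertices are joined through vertex 0. *)
- move=> x y; apply: connect_trans (conn0 y).
  by rewrite (sym_connect_sym (@table_relC _ g)).
- exact: label_bij.
(* Coordinate [j] of the sum is the number of neighbours with digit [j] set, cast to ['Z_2]. *)
move=> x; apply/rowP=> j; have /and3P[_ _ /allP/(_ (val j))] := vtx x.
rewrite mem_iota ltn_ord => /(_ isT) even_j; rewrite summxE.
under eq_bigr do rewrite mxE.
rewrite (big_nbhd _ _ (fun y => (digit j y)%:R)%R) -natr_sum.
have ->: \sum_(y <- neighbours (2 ^ n) g x) digit j y
         = count (digit j) (neighbours (2 ^ n) g x).
  by rewrite -sumn_count sumnE big_map.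
(* An even count is twice its half, and 2 vanishes in ['Z_2]. *)
rewrite -[count _ _]odd_double_half (negbTE even_j) add0n -mul2n natrM.
by rewrite pchar_Zp // mul0r mxE.
Qed.

(** * The explicit graphs, named by power and degree *)

Definition graph_4_5 : seq (seq nat) :=
  [:: [::]; [:: 0]; [:: 1]; [:: 1; 2]; [:: 1]; [:: 0; 1]; [:: 2; 3];
      [:: 0; 5; 6]; [:: 0; 4; 5]; [:: 6]; [:: 3; 9]; [:: 0; 2; 4; 10];
      [:: 4; 8; 10; 11]; [:: 7; 8; 9; 10; 12]; [:: 4; 5; 7; 9];
      [:: 2; 3; 6; 9; 14]].

Definition graph_4_7 : seq (seq nat) :=
  [:: [::]; [:: 0]; [:: 0; 1]; [:: 2]; [:: 0; 1]; [:: 0]; [:: 3; 4; 5];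
      [:: 0; 3; 5]; [:: 1; 2; 7]; [:: 0; 1; 3; 4; 5]; [:: 1; 4; 5; 6; 7];
      [:: 2; 3; 4; 6; 7; 8]; [:: 0; 2; 5; 8; 9; 11]; [:: 1; 2; 6; 8; 12];
      [:: 3; 5; 6; 8; 10; 13]; [:: 3; 4; 7; 9; 10; 13; 14]].

Definition graph_4_9 : seq (seq nat) :=
  [:: [::]; [:: 0]; [:: 0; 1]; [:: 0]; [:: 0; 1; 3]; [:: 0; 1; 2; 4];
      [:: 1; 2; 5]; [:: 2; 3; 4]; [:: 0; 1; 3; 5; 7]; [:: 1; 2; 3; 6; 7; 8];
      [:: 0; 3; 4; 5; 6; 8]; [:: 1; 3; 4; 6; 7; 9]; [:: 3; 4; 5; 6; 7; 9; 11];
      [:: 0; 2; 4; 6; 7; 8; 10; 11]; [:: 0; 2; 7; 8; 9; 10; 12; 13];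
      [:: 1; 2; 3; 5; 6; 10; 11; 12; 14]].

Definition graph_4_11 : seq (seq nat) :=
  [:: [::]; [:: 0]; [:: 1]; [:: 0; 2]; [:: 0; 1]; [:: 0; 1; 2; 3; 4];
      [:: 1; 2; 3; 4]; [:: 0; 2; 3; 4; 6]; [:: 0; 1; 2; 6; 7];
      [:: 2; 3; 4; 5; 7; 8]; [:: 0; 1; 2; 3; 4; 5; 7; 9];
      [:: 0; 1; 3; 4; 5; 6; 7; 8; 9]; [:: 0; 2; 3; 4; 6; 8; 9; 10; 11];
      [:: 1; 3; 5; 6; 7; 8; 9; 10; 12];
      [:: 0; 1; 2; 4; 5; 6; 7; 8; 10; 12; 13];
      [:: 0; 1; 2; 3; 4; 5; 6; 8; 9; 11; 13]].

Definition graph_5_5 : seq (seq nat) :=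
  [:: [::]; [::]; [::]; [::]; [::]; [:: 1]; [:: 2]; [:: 2]; [:: 1; 2]; [::];
      [:: 3]; [:: 3; 10]; [:: 4]; [:: 0; 3; 9]; [:: 8; 10; 11]; [:: 1];
      [:: 1; 11; 14]; [:: 2; 8; 9; 12; 15]; [:: 1; 4; 15]; [:: 0; 7; 9; 16];
      [:: 6; 13; 15]; [:: 5; 6; 9; 18]; [:: 7; 12; 15]; [:: 3; 5; 11; 16];
      [:: 2; 5; 12; 21]; [:: 0; 4; 14; 20]; [:: 0; 4; 7; 9; 10];
      [:: 3; 5; 12; 22]; [:: 6; 8; 10; 27]; [:: 0; 4; 7; 20; 23];
      [:: 13; 19; 24; 25]; [:: 6; 18; 22; 28; 30]].

(** The vertices 0, 1, 4, 5, a subspace of labels with zero sum, are twins: their common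
    neighbourhood is 6, 11, 13, 19, 21, 24, 30. *)
Definition graph_5_7 : seq (seq nat) :=
  [:: [::]; [::]; [::]; [::]; [::]; [::]; [:: 0; 1; 4; 5]; [:: 3; 6]; [:: 2];
      [:: 2]; [:: 3]; [:: 0; 1; 2; 4; 5; 8; 10]; [:: 2; 7; 8];
      [:: 0; 1; 4; 5; 12]; [:: 2; 3; 10]; [:: 12]; [:: 13; 14; 15];
      [:: 2; 3; 7]; [:: 9; 10; 12; 16]; [:: 0; 1; 3; 4; 5; 17; 18];
      [:: 7; 9; 14; 16]; [:: 0; 1; 4; 5; 15; 20]; [:: 9; 16; 17; 18];
      [:: 7; 9; 10; 14; 15]; [:: 0; 1; 4; 5; 14; 23]; [:: 2; 20; 22; 24];
      [:: 3; 6; 15; 18; 25]; [:: 3; 7; 8; 9; 15; 21];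
      [:: 8; 10; 13; 16; 17; 20; 26]; [:: 6; 8; 12; 22; 23; 25; 26];
      [:: 0; 1; 4; 5; 9; 22]; [:: 8; 10; 15; 17; 25; 27; 30]].

Definition graph_5_9 : seq (seq nat) :=
  [:: [::]; [::]; [:: 1]; [:: 0; 2]; [:: 2; 3]; [:: 1; 2]; [::]; [:: 1; 5; 6];
      [:: 5; 6]; [:: 2; 3; 8]; [:: 1; 2; 4; 6]; [:: 0; 7]; [:: 5; 6; 9; 10];
      [:: 0; 1; 2; 11]; [:: 3; 6; 12]; [:: 7; 9; 13]; [:: 4; 5; 10; 11; 12];
      [:: 1; 5; 6; 9; 15]; [:: 1; 3; 8; 9; 11; 14; 15; 16]; [:: 4; 16];
      [:: 4; 7; 9; 11; 15; 17]; [:: 2; 6; 11; 16; 19]; [:: 0; 3; 11; 19];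
      [:: 0; 7; 15; 17; 19; 21]; [:: 0; 2; 5; 8; 13; 16; 20];
      [:: 5; 6; 8; 12; 13; 18; 19; 20]; [:: 1; 4; 6; 7; 13; 19; 21; 23; 24];
      [:: 3; 4; 8; 12; 14; 17; 22; 23];
      [:: 10; 12; 13; 14; 15; 17; 21; 22; 24];
      [:: 0; 4; 8; 9; 14; 19; 21; 22; 27];
      [:: 0; 1; 3; 10; 14; 19; 20; 22; 23];
      [:: 0; 7; 8; 10; 11; 14; 15; 22; 25]].

Definition graph_5_11 : seq (seq nat) :=
  [:: [::]; [:: 0]; [:: 1]; [:: 0]; [:: 1; 3]; [::]; [:: 0; 2; 5];
      [:: 3; 5; 6]; [:: 1; 2; 4; 6; 7]; [:: 5; 6]; [:: 2; 3; 4; 9];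
      [:: 2; 3; 4; 7; 8; 10]; [:: 1; 2; 5; 7; 9]; [:: 2; 7; 10; 11];
      [:: 0; 3; 6; 7; 8; 11; 13]; [:: 0; 3; 5; 7; 9; 10; 11];
      [:: 3; 4; 5; 6; 7]; [:: 0; 2; 3; 4; 10; 13; 14]; [:: 0; 1; 5; 8; 13];
      [:: 7; 9; 10; 12; 15; 18]; [:: 1; 2; 3; 5; 6; 8; 9; 16];
      [:: 0; 2; 4; 6; 11; 20]; [:: 3; 5; 14; 16; 17; 19];
      [:: 0; 5; 9; 13; 14; 18]; [:: 1; 4; 9; 12; 13; 16; 18; 19; 20; 21];
      [:: 11; 13; 15; 17; 21; 22]; [:: 0; 10; 12; 16; 18; 19; 21; 22; 23];
      [:: 4; 8; 12; 18; 21; 22; 23; 25];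
      [:: 4; 5; 12; 14; 15; 17; 18; 19; 25; 27];
      [:: 1; 9; 10; 16; 19; 22; 23; 24; 25; 26; 27];
      [:: 0; 1; 6; 8; 12; 16; 23; 25; 26; 27; 28];
      [:: 1; 2; 9; 13; 15; 17; 20; 21; 22; 23; 25]].

Definition graph_5_13 : seq (seq nat) :=
  [:: [::]; [:: 0]; [:: 1]; [:: 0; 1]; [:: 3]; [::]; [:: 0; 2; 3];
      [:: 2; 4; 5; 6]; [:: 0; 1; 2; 4; 6]; [:: 0; 1; 5; 8]; [:: 3; 8];
      [:: 1; 5; 7]; [:: 0; 5; 8; 9; 10; 11]; [:: 1; 5; 6; 8; 10; 11];
      [:: 2; 3; 4; 7; 9]; [:: 0; 3; 4; 6; 7; 9; 10; 12; 13];
      [:: 5; 9; 11; 12; 14]; [:: 2; 3; 5; 7; 9; 10; 14];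
      [:: 0; 1; 2; 3; 5; 7; 8; 17]; [:: 1; 3; 4; 6; 10; 16; 18];
      [:: 1; 2; 6; 8; 11; 13; 14; 16];
      [:: 2; 5; 6; 10; 11; 14; 15; 16; 18; 19]; [:: 1; 2; 4; 5; 7; 9; 13];
      [:: 0; 2; 4; 5; 9; 10; 11; 14; 15; 16; 20; 21];
      [:: 0; 1; 6; 8; 9; 10; 13; 14; 15; 21; 22];
      [:: 0; 3; 4; 5; 6; 7; 9; 19; 20; 22];
      [:: 4; 5; 12; 13; 14; 16; 17; 18; 20; 22; 25];
      [:: 2; 11; 13; 16; 17; 18; 19; 22; 23; 26];
      [:: 3; 7; 10; 11; 12; 16; 17; 18; 19; 20; 24; 27];
      [:: 0; 1; 3; 4; 8; 11; 12; 16; 19; 20; 26; 27];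
      [:: 2; 4; 10; 11; 12; 14; 15; 17; 19; 22; 25; 27; 28];
      [:: 0; 4; 6; 7; 10; 12; 13; 17; 21; 22; 24; 25; 29]].

Definition graph_5_15 : seq (seq nat) :=
  [:: [::]; [:: 0]; [::]; [:: 0; 1]; [:: 2; 3]; [:: 0; 4]; [:: 0; 1; 2; 5];
      [:: 0; 4; 5; 6]; [:: 0; 2; 5]; [:: 3; 5; 6; 7]; [:: 1; 4; 5; 7; 8; 9];
      [:: 1; 2; 4; 6; 7; 10]; [:: 0; 2; 5; 6; 7; 9];
      [:: 2; 3; 4; 7; 8; 10; 11]; [:: 0; 2; 3; 4; 5; 6; 8; 10; 11];
      [:: 0; 3; 4; 8; 9; 11; 12]; [:: 0; 1; 11; 14; 15];
      [:: 0; 1; 6; 7; 8; 9; 10; 11; 15]; [:: 3; 7; 12; 13; 14; 16; 17];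
      [:: 2; 3; 4; 5; 6; 8; 9; 10; 15; 16; 18];
      [:: 3; 4; 5; 6; 8; 9; 11; 16; 17; 18];
      [:: 2; 3; 4; 5; 6; 8; 9; 10; 12; 13; 14; 16];
      [:: 1; 2; 11; 12; 14; 16; 17; 18; 19; 20];
      [:: 1; 7; 9; 12; 13; 14; 15; 19; 20; 21];
      [:: 0; 1; 4; 5; 7; 8; 11; 12; 15; 18; 20];
      [:: 0; 2; 3; 4; 8; 9; 14; 18; 20; 23; 24];
      [:: 1; 2; 3; 10; 12; 16; 17; 19; 21; 22; 23; 25];
      [:: 1; 5; 11; 12; 13; 16; 17; 18; 19; 22; 24; 25; 26];
      [:: 0; 1; 2; 6; 8; 10; 13; 18; 22; 23; 24; 25; 26];
      [:: 3; 4; 5; 7; 9; 13; 15; 16; 18; 20; 22; 23; 27; 28];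
      [:: 1; 2; 3; 6; 9; 13; 15; 16; 17; 22; 25; 26; 27; 29];
      [:: 0; 1; 2; 7; 8; 10; 12; 13; 15; 16; 21; 23; 24; 28; 30]].

(** The complement is 4-regular. As all vectors of $(\mathbb{Z}_2)^5$ sum to zero, the magic
    condition amounts to every closed neighbourhood of the complement having zero sum. *)
Definition graph_5_27 : seq (seq nat) :=
  [:: [::]; [:: 0]; [:: 0]; [:: 0; 1; 2]; [:: 1; 2; 3]; [:: 0; 1; 2; 3];
      [:: 0; 1; 4; 5]; [:: 0; 1; 2; 3; 4; 5; 6]; [:: 0; 1; 2; 3; 4; 5; 6];
      [:: 0; 1; 2; 3; 4; 6; 7; 8]; [:: 0; 1; 2; 3; 4; 5; 6; 7; 8];
      [:: 0; 2; 3; 4; 5; 6; 7; 8; 9; 10]; [:: 0; 1; 2; 4; 5; 6; 7; 9; 10; 11];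
      [:: 0; 1; 2; 3; 4; 5; 6; 7; 8; 9; 10; 12];
      [:: 0; 1; 2; 3; 4; 5; 6; 8; 9; 11; 12; 13];
      [:: 1; 2; 3; 4; 5; 6; 7; 8; 9; 10; 11; 12; 14];
      [:: 0; 1; 2; 3; 4; 5; 8; 9; 10; 11; 12; 13; 15];
      [:: 0; 1; 3; 4; 5; 6; 8; 9; 10; 12; 13; 14; 15; 16];
      [:: 0; 1; 2; 3; 4; 5; 6; 7; 8; 10; 11; 12; 13; 14; 15; 16; 17];
      [:: 0; 1; 2; 3; 4; 6; 7; 8; 9; 10; 11; 13; 15; 16; 17; 18];
      [:: 0; 1; 3; 4; 5; 6; 7; 8; 10; 11; 13; 14; 15; 16; 17; 18];
      [:: 0; 1; 2; 3; 4; 5; 6; 7; 8; 9; 10; 11; 12; 14; 15; 16; 17; 18; 19;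
          20];
      [:: 2; 3; 4; 5; 6; 7; 8; 9; 10; 12; 13; 14; 15; 16; 17; 18; 19; 20;
          21];
      [:: 0; 1; 2; 4; 5; 7; 8; 9; 11; 12; 13; 14; 15; 16; 17; 18; 19; 20;
          21; 22];
      [:: 0; 1; 2; 3; 4; 5; 6; 7; 9; 10; 11; 12; 13; 14; 15; 16; 17; 18; 19;
          20; 21; 22];
      [:: 0; 1; 2; 3; 4; 5; 6; 7; 8; 9; 10; 11; 12; 13; 14; 16; 17; 18; 19;
          20; 22; 23];
      [:: 0; 1; 2; 3; 4; 5; 6; 7; 8; 9; 11; 12; 13; 14; 15; 16; 17; 19; 20;
          21; 22; 23; 24; 25];
      [:: 0; 1; 2; 3; 4; 6; 7; 9; 10; 11; 12; 13; 14; 16; 17; 18; 19; 20;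
          21; 22; 23; 24; 26];
      [:: 0; 1; 2; 3; 4; 5; 6; 7; 8; 9; 10; 11; 12; 14; 15; 16; 17; 19; 20;
          23; 24; 25; 26; 27];
      [:: 1; 2; 3; 4; 5; 6; 7; 8; 9; 10; 11; 12; 13; 14; 15; 16; 17; 19; 20;
          22; 23; 24; 25; 27; 28];
      [:: 0; 2; 5; 6; 7; 8; 9; 10; 11; 12; 13; 14; 15; 16; 17; 18; 19; 20;
          21; 22; 23; 25; 26; 27; 28; 29];
      [:: 0; 1; 2; 3; 5; 6; 7; 8; 9; 10; 11; 12; 13; 14; 15; 18; 19; 20; 21;
          22; 23; 24; 25; 27; 28; 29; 30]].

Definition graph_6_9 : seq (seq nat) :=
  [:: [::]; [::]; [::]; [:: 0]; [::]; [::]; [::]; [:: 3; 6]; [:: 4; 5];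
      [:: 1; 2; 4]; [::]; [:: 7]; [:: 9; 10]; [:: 1; 8; 11]; [:: 0; 1; 3];
      [:: 5; 11]; [:: 1; 5; 10]; [:: 10]; [:: 11; 16; 17]; [:: 2; 4; 6; 15];
      [:: 14; 16]; [:: 2; 5; 16; 20]; [:: 4; 12; 15]; [:: 2; 9; 22];
      [:: 3; 22]; [:: 10]; [:: 1; 10; 11; 14; 20]; [:: 3; 5; 16; 24; 25];
      [:: 0; 2; 4; 15; 19]; [:: 17; 21; 28]; [:: 20; 22; 25; 28];
      [:: 6; 22; 30]; [:: 0; 13; 22]; [:: 6; 8; 18];
      [:: 6; 9; 19; 20; 24; 25; 31]; [:: 2; 4; 6]; [:: 6; 7; 24; 33; 34];
      [:: 24; 33]; [:: 2; 19; 25]; [:: 7; 17; 24; 26; 29; 37];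
      [:: 1; 2; 25; 33; 39]; [:: 2; 3; 15; 22; 29; 37];
      [:: 1; 3; 8; 11; 27; 33; 35; 39]; [:: 9; 12; 16; 17; 21; 25; 31; 35];
      [:: 10; 11; 19; 33]; [:: 5; 13; 14; 16; 30; 32; 36; 37; 41];
      [:: 0; 9; 20; 23; 28; 39]; [:: 0; 10; 14; 18; 29; 37; 40];
      [:: 5; 7; 21; 35; 38; 41]; [:: 7; 13; 14; 18; 31; 38; 44];
      [:: 4; 10; 12; 29; 30; 34; 36; 40; 47];
      [:: 0; 3; 8; 15; 18; 32; 33; 44]; [:: 0; 12; 24; 25; 31; 43; 46; 47];
      [:: 4; 11; 13; 15; 23; 29; 31; 38]; [:: 6; 8; 13; 32; 37; 38; 44; 48];
      [:: 0; 7; 17; 28; 31; 32; 35; 38; 48];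
      [:: 1; 8; 15; 18; 20; 27; 30; 49; 52];
      [:: 5; 6; 17; 21; 23; 32; 37; 46]; [:: 1; 3; 8; 12; 27; 36; 37; 44; 48];
      [:: 7; 9; 17; 19; 20; 35; 49; 51; 57];
      [:: 4; 12; 17; 21; 23; 25; 26; 46; 54];
      [:: 5; 13; 23; 32; 35; 38; 41; 44];
      [:: 11; 12; 18; 23; 24; 26; 29; 40; 53];
      [:: 10; 14; 26; 27; 30; 36; 40; 42; 61]].

(** Invariant under the linear map of order 3 on labels that cycles 2, 4, 6 and fixes 1, 8, 16, 32,
    64; the 128 vertices fall into 32 fixed points and 32 orbits of length 3. *)
Definition graph_7_13 : seq (seq nat) :=
  [:: [::]; [::]; [::]; [::]; [:: 2]; [::]; [:: 2; 4]; [::]; [::]; [:: 1];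
      [::]; [:: 10]; [::]; [:: 10; 12]; [:: 11]; [:: 12; 14]; [:: 8; 9];
      [:: 1; 9]; [:: 8; 10]; [:: 10; 12; 18]; [:: 8; 12]; [:: 12; 14; 18; 20];
      [:: 8; 14; 19]; [:: 10; 14; 20; 22]; [:: 8; 10; 12; 14; 16; 17];
      [:: 1; 8; 9; 17]; [:: 10; 11; 15; 16; 18]; [:: 18; 20; 26];
      [:: 11; 12; 13; 16; 20]; [:: 20; 22; 26; 28];
      [:: 13; 14; 15; 16; 22; 27]; [:: 18; 22; 28; 30];
      [:: 8; 10; 12; 14; 16; 17]; [:: 8; 9]; [:: 2; 9; 11; 15; 22];
      [:: 3; 7; 28]; [:: 4; 9; 11; 13; 18; 35]; [:: 3; 5; 30];
      [:: 6; 9; 13; 15; 20; 37]; [:: 5; 7; 26; 34]; [:: 0]; [::];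
      [:: 5; 14; 15; 22; 23; 30; 31]; [:: 2; 4; 38; 39; 41];
      [:: 7; 10; 11; 18; 19; 26; 27; 42]; [:: 4; 6; 34; 35; 41; 43];
      [:: 3; 12; 13; 20; 21; 28; 29; 42; 44]; [:: 2; 6; 36; 37; 41; 43; 45];
      [:: 8; 9; 24; 26; 28; 30; 32]; [:: 24; 25; 32; 33];
      [:: 2; 14; 25; 27; 31; 45]; [:: 3; 7; 20; 37; 39; 45];
      [:: 4; 10; 25; 27; 29; 47; 51]; [:: 3; 5; 22; 35; 39; 47];
      [:: 6; 12; 25; 29; 31; 43; 53]; [:: 5; 7; 18; 35; 37; 43; 50];
      [:: 16; 18; 20; 22; 24; 25; 32; 33; 48]; [:: 16; 17; 33; 48; 49];
      [:: 2; 17; 19; 23; 30; 45]; [:: 3; 7; 12; 37; 39; 45; 53; 55];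
      [:: 4; 17; 19; 21; 26; 47; 59]; [:: 3; 5; 14; 35; 39; 47; 51; 55];
      [:: 6; 17; 21; 23; 28; 43; 61]; [:: 5; 7; 10; 35; 37; 43; 51; 53; 58];
      [:: 1; 40; 41]; [:: 11; 13; 15; 19; 21; 23; 27; 29; 31; 64];
      [:: 1; 44; 47]; [:: 2; 5; 9; 17; 25; 41; 46]; [:: 1; 43; 46; 66];
      [:: 4; 7; 9; 17; 25; 41; 42; 67]; [:: 1; 42; 45; 66; 68];
      [:: 3; 6; 9; 17; 25; 41; 44; 67; 69];
      [:: 11; 13; 15; 33; 41; 48; 58; 60; 62];
      [:: 24; 33; 34; 36; 38; 48; 56; 65]; [:: 10; 11; 19; 33; 61];
      [:: 0; 13; 20; 40; 55; 64]; [:: 12; 13; 21; 33; 63];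
      [:: 0; 15; 22; 40; 51; 64; 75]; [:: 14; 15; 23; 33; 59];
      [:: 0; 11; 18; 40; 53; 64; 75; 77];
      [:: 19; 21; 23; 32; 41; 50; 52; 54; 57; 72];
      [:: 8; 32; 48; 57; 58; 60; 62; 65; 73; 74; 76; 78];
      [:: 18; 19; 27; 53; 57; 74; 78]; [:: 0; 21; 28; 39; 40; 64; 75; 76];
      [:: 20; 21; 29; 55; 57; 74; 76]; [:: 0; 23; 30; 35; 40; 64; 77; 78; 83];
      [:: 22; 23; 31; 51; 57; 76; 78];
      [:: 0; 19; 26; 37; 40; 64; 74; 79; 83; 85];
      [:: 27; 29; 31; 34; 36; 38; 41; 49; 56; 72; 80];
      [:: 16; 32; 49; 50; 52; 54; 56; 65; 73; 81; 82; 84; 86];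
      [:: 11; 26; 27; 37; 49; 73; 74; 76; 79; 82; 86];
      [:: 0; 12; 29; 40; 63; 64; 75; 83; 84];
      [:: 13; 28; 29; 39; 49; 73; 75; 76; 78; 82; 84];
      [:: 0; 14; 31; 40; 59; 64; 77; 85; 86; 91];
      [:: 15; 30; 31; 35; 49; 73; 74; 77; 78; 84; 86];
      [:: 0; 10; 27; 40; 61; 64; 79; 82; 87; 91; 93];
      [:: 1; 32; 41; 74; 76; 78; 88]; [:: 3; 5; 7; 67; 69; 71; 88];
      [:: 2; 29; 49; 66]; [:: 8; 36; 52; 59; 60; 66; 93]; [:: 4; 31; 49; 68];
      [:: 8; 38; 54; 61; 62; 68; 95; 98; 99]; [:: 6; 27; 49; 70; 99];
      [:: 8; 34; 50; 58; 63; 70; 91; 99; 100; 101];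
      [:: 2; 4; 6; 40; 43; 45; 47; 96; 97];
      [:: 9; 17; 25; 35; 37; 39; 40; 51; 53; 55; 59; 61; 63];
      [:: 3; 7; 42; 66; 67; 74; 82; 90; 103];
      [:: 0; 1; 6; 38; 44; 54; 62; 66; 77; 85; 93];
      [:: 3; 5; 44; 68; 69; 76; 84; 92; 99; 106];
      [:: 0; 1; 2; 34; 46; 50; 58; 68; 79; 87; 95; 107];
      [:: 5; 7; 46; 70; 71; 78; 86; 94; 101; 106; 108];
      [:: 0; 1; 4; 36; 42; 52; 60; 70; 75; 83; 91; 107; 109];
      [:: 1; 41; 48; 80; 90; 92; 94; 96; 98; 100; 102; 104];
      [:: 3; 5; 7; 67; 69; 71; 80; 97; 98; 100; 102; 104];
      [:: 2; 21; 57; 66; 98; 100; 102];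
      [:: 24; 35; 36; 52; 60; 66; 85; 99; 108];
      [:: 4; 23; 57; 68; 98; 100; 102];
      [:: 24; 37; 38; 54; 62; 68; 87; 101; 110; 114; 115];
      [:: 6; 19; 57; 70; 98; 100; 102; 115];
      [:: 24; 34; 39; 50; 58; 70; 83; 103; 106; 115; 116; 117];
      [:: 1; 41; 56; 72; 82; 84; 86; 96; 104; 112; 114; 116; 118];
      [:: 3; 5; 7; 67; 69; 71; 72; 97; 104; 113; 114; 116; 118];
      [:: 2; 13; 33; 66; 96; 97; 98; 100; 102; 114; 116; 118];
      [:: 16; 36; 51; 52; 60; 66; 77; 99; 108; 115];
      [:: 4; 15; 33; 68; 96; 97; 98; 100; 102; 114; 116; 118];
      [:: 16; 38; 53; 54; 62; 68; 79; 101; 110; 117; 122; 123];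
      [:: 6; 11; 33; 70; 96; 97; 98; 100; 102; 114; 116; 118; 123];
      [:: 16; 34; 50; 55; 58; 70; 75; 103; 106; 119; 123; 124; 125]].

(** * Evaluation of the test on the thirteen tables *)

Theorem theorem5 (n k : nat) :
  [\/ n = 4 /\ k \in [:: 5; 7; 9; 11],
      n = 5 /\ k \in [:: 5; 7; 9; 11; 13; 15; 27],
      n = 6 /\ k = 9
    | n = 7 /\ k = 13] ->
  exists (V : finType) (e : rel V), regular_graph e k /\ open_xor_magic e n.
Proof.
case=> [[-> k_in] | [-> k_in] | [-> ->] | [-> ->]].
- move: k_in; rewrite !inE => /or4P[] /eqP->.
  + by apply: (@magic_tableP _ _ graph_4_5); vm_compute.
  + by apply: (@magic_tableP _ _ graph_4_7); vm_compute.
  + by apply: (@magic_tableP _ _ graph_4_9); vm_compute.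
  + by apply: (@magic_tableP _ _ graph_4_11); vm_compute.
(* Seven degrees: the first [or4P] isolates three of them, the second splits the other four. *)
- move: k_in; rewrite !inE => /or4P[/eqP->|/eqP->|/eqP->|/or4P[] /eqP->].
  + by apply: (@magic_tableP _ _ graph_5_5); vm_compute.
  + by apply: (@magic_tableP _ _ graph_5_7); vm_compute.
  + by apply: (@magic_tableP _ _ graph_5_9); vm_compute.
  + by apply: (@magic_tableP _ _ graph_5_11); vm_compute.
  + by apply: (@magic_tableP _ _ graph_5_13); vm_compute.
  + by apply: (@magic_tableP _ _ graph_5_15); vm_compute.
  + by apply: (@magic_tableP _ _ graph_5_27); vm_compute.
- by apply: (@magic_tableP _ _ graph_6_9); vm_compute.
- by apply: (@magic_tableP _ _ graph_7_13); vm_compute.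
Qed.
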